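(* Let $n\ge 2$ and $1\le k\le n-1$. Let $F\subseteq\Omega_{2n,k}$ be a facet of $\Delta^\ast_{2n,k}$ (i.e. an inclusion-maximal subset of $\Omega_{2n,k}$ containing no $(k+1)$-crossing) such that $F=\bar F$. In other words, $F$ is a facet of the complex $\Delta^{\ast\mathrm{symm}}_{2n,k}$, the subcomplex of $\Delta^\ast_{2n,k}$ generated by the facets $F$ with $F=\bar F$. Then $F$ contains exactly $k$ diameters.
   Context: Label the vertices of a convex regular $2n$-gon by $1,\dots,2n$ in cyclic order. A segment is a $2$-element subset $\{a,b\}\subseteq[2n]$ (the line segment joining the two vertices). Two segments $\{a,b\},\{c,d\}$ cross if their four endpoints are distinct and interleave in the cyclic order, equivalently the open segments meet in the interior of the polygon. A $(k+1)$-crossing is a set of $k+1$ pairwise crossing segments. The cyclic length of $\{a,b\}$ is $\min(|a-b|,2n-|a-b|)$. $\Omega_{2n,k}$ is the set of segments of cyclic length $>k$, and $\Delta^\ast_{2n,k}$ is the simplicial complex on $\Omega_{2n,k}$ whose faces are the subsets containing no $(k+1)$-crossing. The $180^\circ$-rotation sends a segment $d=\{a,b\}$ to $\bar d=\{a+n,b+n\}$ (indices taken modulo $2n$ in $[2n]$), and for a set $M$ of segments $\bar M=\{\bar d: d\in M\}$. A diameter is a segment with $d=\bar d$, i.e. $\{a,a+n\}$. *)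

(* Defs.v *)
From mathcomp Require Import all_boot.

Set Implicit Arguments.
Unset Strict Implicit.
Unset Printing Implicit Defensive.

Section Polygon.

Variable m : nat.

(* The vertices 1, ..., m of the convex m-gon are represented by the ordinals
   0, ..., m-1 in 'I_m. *)
Implicit Types (a b c : 'I_m) (s t : {set 'I_m}) (C F G : {set {set 'I_m}})
  (K : {set {set {set 'I_m}}}).

Definition is_segment s := #|s| == 2.

(* Going around the polygon in the positive direction from a, one meets b
   strictly before c; in particular a, b and c are distinct. *)
Definition cyclic a b c := [|| a < b < c, b < c < a | c < a < b].

(* For segments s = {a, b} and t = {c, d}: the endpoint c lies strictly between
   a and b, and the endpoint d strictly between b and a, in the cyclic order. *)
Definition cross s t :=
  [exists a in s, exists b in s, exists c in t, exists d in t,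
    cyclic a c b && cyclic b d a].

Definition is_crossing (j : nat) C :=
  [&& #|C| == j, [forall s in C, is_segment s] &
      [forall s in C, forall t in C, (s != t) ==> cross s t]].

Definition cyclic_length a b :=
  let dist := maxn a b - minn a b in minn dist (m - dist).

Definition Omega (k : nat) : {set {set 'I_m}} :=
  [set s : {set 'I_m} | [exists a, exists b,
    [&& s == [set a; b], a != b & k < cyclic_length a b]]].

Definition Delta (k : nat) : {set {set {set 'I_m}}} :=
  [set F : {set {set 'I_m}} | (F \subset Omega k) &&
    ~~ [exists C : {set {set 'I_m}}, (C \subset F) && is_crossing k.+1 C]].

Definition facet K F := maxset (fun G => G \in K) F.

End Polygon.

Section Rotation.

Variable n : nat.

Implicit Types (s : {set 'I_(2 * n)}) (F G M : {set {set 'I_(2 * n)}}).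

Definition antipode (i : 'I_(2 * n)) : 'I_(2 * n) :=
  Ordinal (ltn_pmod (i + n) (leq_ltn_trans (leq0n i) (ltn_ord i))).

Definition rot180 s : {set 'I_(2 * n)} := antipode @: s.

Definition rot180_set M : {set {set 'I_(2 * n)}} := rot180 @: M.

Definition is_diameter s := is_segment s && (rot180 s == s).

Definition Delta_symm (k : nat) : {set {set {set 'I_(2 * n)}}} :=
  [set G : {set {set 'I_(2 * n)}} | [exists F : {set {set 'I_(2 * n)}},
    [&& facet (Delta (2 * n) k) F, F == rot180_set F & G \subset F]]].

Lemma facet_Delta_symm (k : nat) F :
  facet (Delta_symm k) F <-> facet (Delta (2 * n) k) F /\ F = rot180_set F.
Proof.
split=> [/maxsetP[]|[facF symF]].
  rewrite inE => /existsP[H /and3P[facH symH sFH]] maxF.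
  have HD : H \in Delta_symm k.
    by rewrite inE; apply/existsP; exists H; rewrite facH symH subxx.
  by rewrite -(maxF H HD sFH); split=> //; apply/eqP.
apply/maxsetP; split=> [|G].
  by rewrite inE; apply/existsP; exists F; rewrite facF -symF eqxx subxx.
rewrite inE => /existsP[H /and3P[facH _ sGH]] sFG.
have [_ maxF] := maxsetP facF; have [HD _] := maxsetP facH.
apply/eqP; rewrite eqEsubset sFG andbT -(maxF H HD) //.
exact: subset_trans sFG sGH.
Qed.

End Rotation.

(* Main.v *)
Require Import Defs.
From mathcomp Require Import all_boot zify.

(** Encode the chord joining the vertices [a] and [b + n] as the point [(a, b)];
the half-turn swaps the coordinates and the diameters are the diagonal points.
Chains of [F], strictly increasing in both coordinates, in a window
[x <= a <= b <= y] with [y < x + n] are crossings, so they have length at most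
[k].  If the diameter at [x] is not in [F], then maximality provides [k] chords
of [F] that cross it and each other, and reflecting them above the diagonal
gives a chain of length [k] in the window from [x + 1] to [x + n - 1].
The maximal chain length of a window is supermodular, so that its drop when [x]
is removed is nondecreasing in [y].  For [x] off the diagonal this drop is [0]
at [y = x + n - 1], hence for all [y]; for [x] on the diagonal it is at most [1].
Therefore a chain is no longer than the number of diameters of [F] in its
window, and the chain of length [k] above shows that there are at least [k]. *)

Set Implicit Arguments.
Unset Strict Implicit.
Unset Printing Implicit Defensive.

(** * Chains in windows and the exchange of two chains *)

Section Chains.

Variable P : rel nat.

Definition is_chain (x y j : nat) (a b : nat -> nat) :=
  (forall i, i < j -> [/\ x <= a i, a i <= b i, b i <= y & P (a i) (b i)]) /\
  (forall i l, i < l -> l < j -> a i < a l /\ b i < b l).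

Lemma is_chain_leq x y j a b i l :
  is_chain x y j a b -> i <= l < j -> a i <= a l /\ b i <= b l.
Proof.
move=> [_ incr] /andP[]; rewrite leq_eqVlt => /predU1P[-> //|ltil ltlj].
by have [] := incr i l ltil ltlj; lia.
Qed.

Definition has_chain (x y j : nat) := exists a b, is_chain x y j a b.

Lemma has_chain0 x y : has_chain x y 0.
Proof. by exists id, id; split=> [[]|i []]. Qed.

Lemma has_chain_sub x y j x' y' j' :
  x' <= x -> y <= y' -> j' <= j -> has_chain x y j -> has_chain x' y' j'.
Proof.
move=> lex ley lej [a [b [win incr]]]; exists a, b; split=> [i ltij|i l ltil ltlj].
  have [] := win i (leq_trans ltij lej); split=> //; lia.
by apply: incr => //; lia.
Qed.

Lemma has_chain_behead x y j : has_chain x y j.+1 -> has_chain x.+1 y j.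
Proof.
move=> [a [b [win incr]]]; exists (a \o succn), (b \o succn).
split=> [i ltij|i l ltil ltlj] /=; last by apply: incr; lia.
have [? ? ? ?] := win i.+1 ltij; have [? _ _ _] := win 0 isT.
have [] := incr 0 i.+1 isT ltij; split=> //; lia.
Qed.

Lemma has_chain_belast x y j : has_chain x y.+1 j.+1 -> has_chain x y j.
Proof.
move=> [a [b [win incr]]]; exists a, b.
split=> [i ltij|i l ltil ltlj]; last by apply: incr; lia.
have [? ? ? ?] := win i (ltnW ltij); have [_ _ ? _] := win j (ltnSn j).
have [] := incr i j ltij (ltnSn j); split=> //; lia.
Qed.

(* Supermodularity of the maximal chain length [c]:
   c [x, y] + c [x+1, y+1] <= c [x+1, y] + c [x, y+1]. *)
Lemma has_chain_exchange x y j :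
  has_chain x y j -> has_chain x.+1 y.+1 j ->
  has_chain x.+1 y j \/ has_chain x y.+1 j.+1.
Proof.
case: j => [_ _|j]; first by left; apply: has_chain0.
move=> [a [b chp]] [c [d chq]]; have [winp incp] := chp; have [winq incq] := chq.
have leq_p i l := is_chain_leq (i := i) (l := l) chp.
have leq_q i l := is_chain_leq (i := i) (l := l) chq.
(* If [c 0 <= a 0], the first chain already starts beyond [x]. *)
have [lt_ac0|] := ltnP (a 0) (c 0); last first.
  move=> le_ca0; left; exists a, b; split=> // i ltij.
  have [? ? ? ?] := winp i ltij; split=> //; have [? _ _ _] := winq 0 isT.
  by have [] := leq_p 0 i; lia.
(* If point [i] of the first chain is strictly below point [i] of the second in both coordinates,
   following the first chain through [i] and then the second from [i] on gains one point. *)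
have [/hasP[i]|/hasPn noq] :=
    boolP (has (fun i => (a i < c i) && (b i < d i)) (iota 0 j.+1)).
  rewrite mem_iota add0n => /= ltij /andP[lt_ac lt_bd]; right.
  exists (fun l => if l <= i then a l else c l.-1),
         (fun l => if l <= i then b l else d l.-1).
  split=> [l ltlj|l r ltlr ltrj].
    case: (leqP l i) => [leli|ltil].
      have [|? ? ? ?] := winp l; first lia.
      by split=> //; lia.
    have [|? ? ? ?] := winq l.-1; first lia.
    by split=> //; lia.
  case: (leqP r i) => [leri|ltir]; case: (leqP l i) => [leli|ltil].
  - by apply: incp; lia.
  - lia.
  - by have [] := leq_p l i; have [] := leq_q i r.-1; lia.
  - by apply: incq; lia.
have below i : i < j.+1 -> a i < c i -> d i <= b i.
  move=> ltij ltac; have := noq i; rewrite mem_iota add0n /= ltij => /(_ isT).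
  by rewrite ltac /= -leqNgt.
left.
(* Switch from the second chain to the first at the least index with [c <= a], which is positive by
   [lt_ac0]. Just before it [a < c], so [below] gives [d <= b] and the splice still increases. *)
have [/hasP exi|/hasPn all_ac] := boolP (has (fun i => c i <= a i) (iota 0 j.+1)).
  have {}exi : exists i, (i < j.+1) && (c i <= a i).
    by have [i] := exi; rewrite mem_iota /= => lti ?; exists i; apply/andP.
  case: (ex_minnP exi) => -[|i] /andP[ltij le_ca] min_i; first lia.
  have lt_ac : a i < c i by rewrite ltnNge; apply/negP => leca; have := min_i i; lia.
  have le_db := below i (ltnW ltij) lt_ac.
  have [? ?] := incp i i.+1 (ltnSn i) ltij.
  have [? ?] := incq i i.+1 (ltnSn i) ltij.
  have [_ _ ? _] := winp i (ltnW ltij).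
  exists (fun l => if l <= i then c l else a l),
         (fun l => if l <= i then d l else b l).
  split=> [l ltlj|l r ltlr ltrj].
    case: (leqP l i) => [leli|ltil].
      have [? ? ? ?] := winq l ltlj; split=> //.
      by have [] := leq_q l i; lia.
    have [? ? ? ?] := winp l ltlj; split=> //.
    have [? _ _ _] := winp 0 isT.
    by have [] := incp 0 l; lia.
  case: (leqP r i) => [leri|ltir]; case: (leqP l i) => [leli|ltil].
  - by apply: incq; lia.
  - lia.
  - by have [] := leq_q l i; have [] := leq_p i.+1 r; lia.
  - by apply: incp; lia.
(* Now [a < c] throughout, so the second chain ends no higher than the first and fits below [y]. *)
have le_dbj : d j <= b j.
  apply: below => //; have := all_ac j; rewrite mem_iota /= add0n ltnSn => /(_ isT).
  by rewrite -ltnNge.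
exists c, d; split=> // l ltlj.
have [? ? ? ?] := winq l ltlj; have [_ _ ? _] := winp j (ltnSn j); split=> //.
by have [] := leq_q l j; lia.
Qed.

(** Distinct elements cannot tie in [lo], so sorting by [lo] makes both coordinates strictly
    increase. *)
Lemma has_chain_set (T : finType) (A : {set T}) (lo hi : T -> nat) x y :
  (forall s, s \in A -> [/\ x <= lo s, lo s <= hi s, hi s <= y & P (lo s) (hi s)]) ->
  (forall s t, s \in A -> t \in A -> s != t ->
     (lo s < lo t) && (hi s < hi t) || (lo t < lo s) && (hi t < hi s)) ->
  has_chain x y #|A|.
Proof.
move=> win cmp; have [->|[s0 As0]] := set_0Vmem A.
  by rewrite cards0; apply: has_chain0.
pose r := relpre lo leq; pose e := sort r (enum A).
have sz_e : size e = #|A| by rewrite size_sort cardE.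
have uniq_e : uniq e by rewrite sort_uniq enum_uniq.
have e_sorted : sorted r e by apply: sort_sorted => s t; apply: leq_total.
have Ae i : i < #|A| -> nth s0 e i \in A.
  by move=> ltiA; rewrite -mem_enum -(mem_sort r) mem_nth // sz_e.
exists (lo \o nth s0 e), (hi \o nth s0 e); split=> [i /Ae/win //|i l ltil ltlA] /=.
have ltiA := ltn_trans ltil ltlA.
have := cmp _ _ (Ae i ltiA) (Ae l ltlA).
rewrite nth_uniq ?sz_e // (ltn_eqF ltil) => /(_ isT).
have : r (nth s0 e i) (nth s0 e l).
  apply: (sorted_leq_nth _ _ _ e_sorted); rewrite ?inE ?sz_e //; last exact: ltnW.
    by move=> ? ? ?; apply: leq_trans.
  by move=> ?; apply: leqnn.
rewrite /r /=; lia.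
Qed.

(** * Bounding chain length by diagonal points *)

Variables n k : nat.

Hypothesis chain_le : forall x j, has_chain x (x + n.-1) j -> j <= k.

Hypothesis chain_off_diagonal :
  forall x, ~~ P x x -> has_chain x.+1 (x + n.-1) k.

(** Descending induction on [y]: at [y = x + n.-1] the chain of [chain_off_diagonal] is as long as
    [chain_le] permits. *)
Lemma has_chain_advance x y j :
  ~~ P x x -> y <= x + n.-1 -> has_chain x y j -> has_chain x.+1 y j.
Proof.
move=> nPx; have [w] := ubnP (x + n.-1 - y).
elim: w y j => // w IHw y j ltw ley chain_j.
have [lty|gey] := ltnP y (x + n.-1); last first.
  have ey : y = x + n.-1 by lia.
  rewrite ey in chain_j *.
  exact: has_chain_sub (chain_le chain_j) (chain_off_diagonal nPx).
have advS i := IHw y.+1 i ltac:(lia) lty.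
(* In the other alternative the longer chain also advances, by induction at [y.+1]; deleting its
   last point brings it back below [y]. *)
have [//|chain_j1] := has_chain_exchange chain_j
  (advS _ (has_chain_sub (leqnn x) (leqnSn y) (leqnn j) chain_j)).
exact: has_chain_belast (advS _ chain_j1).
Qed.

Lemma chain_leq_count x y j :
  y <= x + n.-1 -> has_chain x y j -> j <= \sum_(x <= i < y.+1) P i i.
Proof.
have [w] := ubnP (y.+1 - x); elim: w x j => // w IHw x j ltw ley chain_j.
have [lexy|ltyx] := leqP x y; last first.
  case: j chain_j => // j [a [b [win _]]].
  by have [] := win 0 isT; lia.
rewrite big_ltn ?ltnS //; case: (boolP (P x x)) => [_|nPx] /=.
  case: j chain_j => // j /has_chain_behead/IHw; rewrite ltnS; apply; lia.
by rewrite add0n; apply: IHw; last exact: has_chain_advance; lia.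
Qed.

End Chains.

(** * Vertices and chords in integer coordinates *)

Section Polygon.

Variable n : nat.
Hypothesis n_gt0 : 0 < n.

Implicit Types (s t : {set 'I_(2 * n)}) (F : {set {set 'I_(2 * n)}}).

Lemma double_gt0 : 0 < 2 * n. Proof. lia. Qed.

(** Labels are read modulo [2 * n], so the circle can be cut open at any [x]. *)
Definition vertex (u : nat) : 'I_(2 * n) := Ordinal (ltn_pmod u double_gt0).

(* The second endpoint is [b + n], so the diameters are the chords [chord a a]. *)
Definition chord (a b : nat) : {set 'I_(2 * n)} := [set vertex a; vertex (b + n)].

Lemma vertex_lift x (c : 'I_(2 * n)) : exists2 u, x <= u < x + 2 * n & c = vertex u.
Proof.
have := ltn_pmod x double_gt0; have := divn_eq x (2 * n).
have := ltn_ord c; move: (x %/ _) (x %% _) => q r ltc x_def ltr.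
exists ((if r <= c then q else q.+1) * (2 * n) + c).
  by case: (leqP r c); rewrite ?mulSn; lia.
by apply: val_inj; rewrite /= modnMDl modn_small.
Qed.

(** A window wraps around at most once; the explicit conditional leaves only linear arithmetic in
    [x %% (2 * n)]. *)
Lemma vertex_window x u : x <= u < x + 2 * n ->
  nat_of_ord (vertex u) =
  if x %% (2 * n) + (u - x) < 2 * n then x %% (2 * n) + (u - x)
  else x %% (2 * n) + (u - x) - 2 * n.
Proof.
move=> win /=; have ltr := ltn_pmod x double_gt0.
have {1}-> : u = x + (u - x) by lia.
rewrite -modnDml; case: (ltnP _ (2 * n)) => [lt|ge]; first by rewrite modn_small.
by rewrite -{1}(subnK ge) modnDr modn_small //; lia.
Qed.

Lemma cyclic_vertex x u v w :
  x <= u < x + 2 * n -> x <= v < x + 2 * n -> x <= w < x + 2 * n ->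
  cyclic (vertex u) (vertex v) (vertex w) = [|| u < v < w, v < w < u | w < u < v].
Proof.
move=> winu winv winw; rewrite /cyclic.
rewrite !(vertex_window winu, vertex_window winv, vertex_window winw).
move: (x %% _) (ltn_pmod x double_gt0) => r ltr.
by do 3![case: ifP => ?]; lia.
Qed.

Lemma vertex_eq x u v : x <= u < x + 2 * n -> x <= v < x + 2 * n ->
  (vertex u == vertex v) = (u == v).
Proof.
move=> winu winv; change ((vertex u == vertex v :> nat) = (u == v)).
rewrite (vertex_window winu) (vertex_window winv).
by move: (x %% _) (ltn_pmod x double_gt0) => r ltr; do 2![case: ifP => ?]; lia.
Qed.

Lemma antipode_vertex u : antipode (vertex u) = vertex (u + n).
Proof. by apply: val_inj; rewrite /= modnDml. Qed.

Lemma vertexD2n u : vertex (u + n + n) = vertex u.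
Proof. by apply: val_inj; rewrite /= -addnA addnn -mul2n modnDr. Qed.

Lemma rot180_chord a b : rot180 (chord a b) = chord b a.
Proof.
by rewrite /rot180 /chord imsetU1 imset_set1 !antipode_vertex vertexD2n setUC.
Qed.

Lemma chord_shift a b : chord (a + n) (b + n) = chord b a.
Proof. by rewrite /chord vertexD2n setUC. Qed.

Lemma cross_sym s t : cross s t -> cross t s.
Proof.
move=> /exists_inP[a sa] /exists_inP[b sb] /exists_inP[c tc] /exists_inP[d td].
move=> cyc; apply/exists_inP; exists c => //; apply/exists_inP; exists d => //.
apply/exists_inP; exists b => //; apply/exists_inP; exists a => //.
by move: cyc; rewrite /cyclic; lia.
Qed.

Lemma cross_irr s : is_segment s -> ~~ cross s s.
Proof.
move=> /cards2P[p [q [_ ->]]]; apply/negP.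
move=> /exists_inP[a sa] /exists_inP[b sb] /exists_inP[c sc] /exists_inP[d sd].
move: sa sb sc sd; rewrite !inE /cyclic.
by do 4![case/orP=> /eqP->]; lia.
Qed.

Lemma cross_set2 (p q r t : 'I_(2 * n)) : cross [set p; q] [set r; t] ->
  cyclic p r q && cyclic q t p || cyclic p t q && cyclic q r p.
Proof.
move=> /exists_inP[a sa] /exists_inP[b sb] /exists_inP[c sc] /exists_inP[d sd].
move: sa sb sc sd; rewrite !inE /cyclic.
by do 4![case/orP=> /eqP->]; lia.
Qed.

Lemma card_chord a b : a < b + n < a + 2 * n -> is_segment (chord a b).
Proof.
by move=> ?; rewrite /is_segment cards2 (@vertex_eq a); lia.
Qed.

(** The endpoints occur in the order [a < c < b + n < d + n < a + 2 * n]. *)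
Lemma cross_chord a b c d : a <= b -> a < c -> b < d -> c <= d -> d < a + n ->
  cross (chord a b) (chord c d).
Proof.
move=> ? ? ? ? ?.
apply/exists_inP; exists (vertex a); first by rewrite !inE eqxx.
apply/exists_inP; exists (vertex (b + n)); first by rewrite !inE eqxx orbT.
apply/exists_inP; exists (vertex c); first by rewrite !inE eqxx.
apply/exists_inP; exists (vertex (d + n)); first by rewrite !inE eqxx orbT.
by rewrite !(@cyclic_vertex a); lia.
Qed.

Lemma diameterP s : is_diameter s -> exists2 a, a < n & s = chord a a.
Proof.
move=> /andP[/cards2P[p [q [neq_pq ->]]] /eqP rot_s].
have : antipode p \in [set p; q] by rewrite -rot_s imset_f // !inE eqxx.
have [u ltu p_def] := vertex_lift 0 p; rewrite {}p_def antipode_vertex in rot_s neq_pq *.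
rewrite !inE (@vertex_eq u); [|lia..].
have -> /= : (u + n == u) = false by lia.
move=> /eqP <-; have [ltun|leun] := ltnP u n; first by exists u.
exists (u - n); first lia.
by rewrite -chord_shift subnK.
Qed.

Lemma is_diameter_chord a : is_diameter (chord a a).
Proof. by rewrite /is_diameter rot180_chord eqxx card_chord //; lia. Qed.

Lemma chord_diameter_inj x a b : x <= a < x + n -> x <= b < x + n ->
  chord a a = chord b b -> a = b.
Proof.
move=> wina winb eq_ab; have : vertex a \in chord b b by rewrite -eq_ab !inE eqxx.
rewrite !inE !(@vertex_eq x); lia.
Qed.

Lemma chord_Omega k a : k < n -> chord a a \in Omega (2 * n) k.
Proof.
move=> ltkn; rewrite inE; apply/existsP; exists (vertex a).
apply/existsP; exists (vertex (a + n)); rewrite eqxx (@vertex_eq a); [|lia..].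
have win1 : a <= a < a + 2 * n by lia.
have win2 : a <= a + n < a + 2 * n by lia.
rewrite /cyclic_length (vertex_window win1) (vertex_window win2).
move: (a %% _) (ltn_pmod a double_gt0) => r ltr.
by do 2![case: ifP => ?]; lia.
Qed.

(** One endpoint lies on each side of the diameter; subtracting [n] from the farther one gives
    [v]. *)
Lemma cross_diameter x s : is_segment s -> cross (chord x x) s ->
  exists u v, [/\ x < u < x + n, x < v < x + n & s = chord u v].
Proof.
move=> /cards2P[p [q [_ ->]]].
have [u ltu ->] := vertex_lift x p; have [v ltv ->] := vertex_lift x q.
move=> /cross_set2; rewrite !(@cyclic_vertex x); [|lia..].
case/orP=> ?; [exists u, (v - n)|exists v, (u - n)]; split; try lia.
  by rewrite /chord subnK //; lia.
by rewrite setUC /chord subnK //; lia.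
Qed.

Lemma cross_chord_comparable x u v u' v' :
  x < u < x + n -> x < v < x + n -> x < u' < x + n -> x < v' < x + n ->
  cross (chord u v) (chord u' v') ->
  (u < u') && (v < v') || (u' < u) && (v' < v).
Proof.
by move=> ? ? ? ? /cross_set2; rewrite !(@cyclic_vertex x); lia.
Qed.

(** * Chains and diameters of a symmetric facet *)

Section Facet.

Variables (k : nat) (F : {set {set 'I_(2 * n)}}).
Hypotheses (lt_kn : k < n) (facF : facet (Delta (2 * n) k) F).
Hypothesis symF : F = rot180_set F.

Let P : rel nat := fun a b => chord a b \in F.

Lemma facet_crossing (C : {set {set 'I_(2 * n)}}) :
  C \subset F -> ~~ is_crossing k.+1 C.
Proof.
move=> sCF; have [] := maxsetP facF; rewrite inE => /andP[_ /existsPn/(_ C)].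
by rewrite sCF.
Qed.

Lemma facet_chain_leq x j : has_chain P x (x + n.-1) j -> j <= k.
Proof.
move=> chain_j; rewrite leqNgt; apply/negP => lt_kj.
have [a [b [win incr]]] := has_chain_sub (leqnn _) (leqnn _) lt_kj chain_j.
pose f (i : 'I_k.+1) := chord (a i) (b i).
have seg_f i : is_segment (f i).
  by have [] := win i (ltn_ord i); move=> *; apply: card_chord; lia.
have cross_lt (i l : 'I_k.+1) : i < l -> cross (f i) (f l).
  move=> ltil; have [? ? ? _] := win i (ltn_ord i).
  have [? ? ? _] := win l (ltn_ord l); have [? ?] := incr _ _ ltil (ltn_ord l).
  by apply: cross_chord; lia.
have cross_f i l : i != l -> cross (f i) (f l).
  rewrite -val_eqE neq_ltn => /orP[/cross_lt //|/cross_lt]; exact: cross_sym.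
have inj_f : injective f.
  move=> i l eq_f; apply/eqP; apply/negPn/negP => /cross_f.
  by rewrite eq_f; apply/negP/cross_irr.
have /negP[] : ~~ is_crossing k.+1 (f @: [set: 'I_k.+1]).
  apply: facet_crossing; apply/subsetP => _ /imsetP[i _ ->].
  by have [] := win i (ltn_ord i).
rewrite /is_crossing card_imset // cardsT card_ord eqxx /=; apply/andP; split.
  by apply/forall_inP => _ /imsetP[i _ ->].
apply/forall_inP => _ /imsetP[i _ ->]; apply/forall_inP => _ /imsetP[l _ ->].
by apply/implyP => neq; apply: cross_f; apply: contraNneq neq => ->.
Qed.

(* Reflecting each chord that crosses the diameter [chord x x] to one side
   keeps the chords pairwise crossing: coordinatewise minima and maxima of
   strictly comparable pairs are strictly comparable. *)
Lemma facet_chain x : ~~ P x x -> has_chain P x.+1 (x + n.-1) k.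
Proof.
move=> nFx; have [DF maxF] := maxsetP facF.
have sFO : F \subset Omega (2 * n) k by move: DF; rewrite inE => /andP[].
have: chord x x |: F \notin Delta (2 * n) k.
  apply: contra nFx => DxF; rewrite /P -(maxF _ DxF (subsetUr _ _)).
  by rewrite !inE eqxx.
rewrite inE subUset sub1set chord_Omega // sFO /= negbK.
case/existsP=> C /andP[sCxF crossC].
(* A crossing avoiding the added diameter would lie in [F]. *)
have Cx : chord x x \in C.
  apply: contraLR crossC => nCx; apply: facet_crossing; apply/subsetP => s Cs.
  have := subsetP sCxF s Cs; rewrite !inE => /orP[/eqP eq_s|//].
  by rewrite -eq_s Cs in nCx.
have [/eqP cardC /forall_inP segC /forall_inP crC] := and3P crossC.
have cross_C s t : s \in C -> t \in C -> s != t -> cross s t.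
  by move=> /crC/forall_inP crs /crs/implyP.
pose A := C :\ chord x x.
have AP s : s \in A -> [/\ s != chord x x, s \in C & s \in F].
  rewrite 2!inE => /andP[ne Cs]; split=> //.
  by have := subsetP sCxF s Cs; rewrite !inE (negPf ne).
have /fin_all_exists[f fP] : forall s, exists uv : nat * nat, s \in A ->
    [/\ x < uv.1 < x + n, x < uv.2 < x + n & s = chord uv.1 uv.2].
  move=> s; have [/AP[ne Cs _]|_] := boolP (s \in A); last by exists (0, 0).
  have [|u [v uvP]] := @cross_diameter x s (segC s Cs); last by exists (u, v).
  by apply: cross_C; rewrite // eq_sym.
have -> : k = #|A| by have := cardsD1 (chord x x) C; rewrite cardC Cx => -[].
apply: (has_chain_set (lo := fun s => minn (f s).1 (f s).2)
                      (hi := fun s => maxn (f s).1 (f s).2)) => [s As|s t As At neq].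
  have [? ? s_def] := fP s As; have [_ _ Fs] := AP s As; split; try lia.
  (* A chord below the diagonal is replaced by its half-turn, which is in [F] by symmetry. *)
  rewrite /P /minn /maxn; case: ltnP => _; first by rewrite -s_def.
  by rewrite -rot180_chord -s_def symF imset_f.
have [? ? s_def] := fP s As; have [? ? t_def] := fP t At.
have [_ Cs _] := AP s As; have [_ Ct _] := AP t At.
have := cross_C s t Cs Ct neq; rewrite s_def t_def => /cross_chord_comparable.
rewrite -s_def -t_def => /(_ x); lia.
Qed.

(** Indexed by numbers below [n], the diameters form a chain on the diagonal. *)
Lemma card_diameters_leq : #|[set d in F | is_diameter d]| <= k.
Proof.
set D := [set d in F | _].
have /fin_all_exists[f fP] : forall s, exists a, s \in D -> a < n /\ s = chord a a.
  move=> s; have [|_] := boolP (s \in D); last by exists 0.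
  by rewrite inE => /andP[_ /diameterP[a lta ->]]; exists a.
apply: (@facet_chain_leq 0); apply: (has_chain_set (lo := f) (hi := f)).
  move=> s Ds; have [? s_def] := fP s Ds; split; try lia.
  by rewrite /P -s_def; move: Ds; rewrite inE => /andP[].
move=> s t Ds Dt neq; have [_ s_def] := fP s Ds; have [_ t_def] := fP t Dt.
have : f s != f t by apply: contraNneq neq => eq_f; rewrite s_def t_def eq_f.
lia.
Qed.

Lemma sum_diameters_leq x :
  \sum_(x <= i < x + n) P i i <= #|[set d in F | is_diameter d]|.
Proof.
have inj : {in index_iota x (x + n) &, injective (fun i => chord i i)}.
  by move=> i l; rewrite !mem_index_iota; apply: chord_diameter_inj.
pose e := [seq chord i i | i <- index_iota x (x + n) & P i i].
have uniq_e : uniq e.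
  rewrite map_inj_in_uniq ?filter_uniq ?iota_uniq // => i l.
  by rewrite !mem_filter => /andP[_ wini] /andP[_ winl]; apply: inj.
have -> : \sum_(x <= i < x + n) P i i = size e.
  rewrite size_map size_filter -sum1_count [RHS]big_mkcond.
  by apply: eq_bigr => i _; case: (P i i).
rewrite -(card_uniqP uniq_e); apply/subset_leq_card/subsetP => s.
move=> /mapP[i]; rewrite mem_filter => /andP[Pi _] ->.
by rewrite inE is_diameter_chord andbT.
Qed.

Lemma card_diameters : #|[set d in F | is_diameter d]| = k.
Proof.
apply/eqP; rewrite eqn_leq card_diameters_leq /=.
(* Otherwise [F] would contain [n > k] diameters. *)
have [x nPx] : exists x, ~~ P x x.
  have [/hasP[x _ nPx]|/hasPn allP] := boolP (has (fun x => ~~ P x x) (iota 0 n)).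
    by exists x.
  have := leq_trans (sum_diameters_leq 0) card_diameters_leq.
  rewrite add0n big_seq (eq_bigr (fun=> 1)) => [|i].
    by rewrite -big_seq sum_nat_const_nat subn0 muln1; lia.
  by rewrite /index_iota subn0 => /allP; rewrite negbK => ->.
apply: leq_trans (sum_diameters_leq x).
(* Dropping the term at [x] leaves exactly the window of the chain from [facet_chain]. *)
rewrite big_ltn; last lia.
apply: leq_trans (leq_addl _ _).
have -> : x + n = (x + n.-1).+1 by lia.
by apply: (chain_leq_count facet_chain_leq facet_chain); [lia | apply: facet_chain].
Qed.

End Facet.

End Polygon.

Theorem theorem3p1 (n k : nat) (F : {set {set 'I_(2 * n)}}) :
  2 <= n -> 1 <= k <= n - 1 ->
  facet (Delta (2 * n) k) F -> F = rot180_set F ->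
  #|[set d in F | is_diameter d]| = k.
Proof.
move=> n_ge2 /andP[_ le_kn]; apply: card_diameters; lia.
Qed.
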